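(* Let $p\ge 1$, $k\ge 1$ an integer and $\delta\in(0,1)$. Any algorithm that accesses a real square matrix ${\bm{A}}$ via matrix-vector multiplication queries, where the query vectors may be adaptively chosen and their entries are specified by $k$ bits, and that for every real square matrix ${\bm{A}}$ outputs an estimate $t$ such that with probability at least $1-\delta$, $|t-\operatorname{tr}({\bm{A}})|\le 0.1\|{\bm{A}}\|_p$, requires at least $$\Omega\!\left(\frac{\log(1/\delta)}{k+\log\log(1/\delta)}\right)$$ queries.
   Context: $\|\cdot\|_p$ is the Schatten-$p$ norm (the $\ell_p$ norm of the singular values). In the matrix-vector query model the algorithm chooses vectors $q_1,q_2,\dots$, each possibly depending on previous answers, and receives ${\bm{A}}q_1,{\bm{A}}q_2,\dots$; each entry of each query vector is specified using $k$ bits.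
   Formalization: log log(1/δ) is replaced by max(0, log log(1/δ)), which changes nothing for δ ≤ 1/e; for larger δ the literal denominator can vanish (k=1, log(1/δ)=1/e), and near there the bound fails. The number of queries is the worst case over all dimensions, matrices and coins. *)

(* Defs.v *)
From HB Require Import structures.
From mathcomp Require Import all_boot all_order all_algebra.
From mathcomp Require Import all_classical all_reals all_analysis.
From mathcomp Require Import polyrcf.

Set Implicit Arguments.
Unset Strict Implicit.
Unset Printing Implicit Defensive.

Import Order.TTheory GRing.Theory Num.Theory.

Local Open Scope ring_scope.

Section Schatten.
Variables (R : realType) (n : nat).

(* Square roots of the eigenvalues of A^T A. [rootsR] lists each real root
   once, so every eigenvalue is repeated according to its multiplicity; A^T A
   being symmetric, all its eigenvalues are real and nonnegative. *)
Definition singular_values (A : 'M[R]_n) : seq R :=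
  let chi := char_poly (A^T *m A) in
  flatten [seq nseq (mup x chi) (Num.sqrt x) | x <- rootsR chi].

Definition schatten_norm (p : R) (A : 'M[R]_n) : R :=
  (\sum_(s <- singular_values A) s `^ p) `^ p^-1.

End Schatten.

Section QueryModel.
Variables (R : realType) (k n : nat).

(* A deterministic adaptive algorithm on n x n matrices, as a decision tree:
   it either stops and outputs a number, or asks a query, each entry of which
   is a string of k bits, and continues according to the vector received. *)
Inductive mv_tree : Type :=
| Output of R
| Query of 'cV[k.-tuple bool]_n & ('cV[R]_n -> mv_tree).

Variables (decode : k.-tuple bool -> R) (A : 'M[R]_n).

Fixpoint tree_output (t : mv_tree) : R :=
  match t with
  | Output r => r
  | Query q next => tree_output (next (A *m map_mx decode q))
  end.

Fixpoint tree_queries (t : mv_tree) : nat :=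
  match t with
  | Output _ => 0
  | Query q next => (tree_queries (next (A *m map_mx decode q))).+1
  end.

End QueryModel.

(* A randomized algorithm on n x n matrices whose random coins are the points
   of T. The interpretation of k-bit strings as real numbers (integers, fixed
   point, floating point, etc) is an arbitrary choice of the algorithm. *)
Record mv_algorithm (R : realType) (k : nat) (T : Type) (n : nat) : Type :=
  MvAlgorithm {
    mv_decode : k.-tuple bool -> R ;
    mv_strategy : T -> mv_tree R k n }.

Definition mv_output (R : realType) (k : nat) (T : Type) (n : nat)
    (alg : mv_algorithm R k T n) (A : 'M[R]_n) (w : T) : R :=
  tree_output (mv_decode alg) A (mv_strategy alg w).

Definition mv_queries (R : realType) (k : nat) (T : Type) (n : nat)
    (alg : mv_algorithm R k T n) (A : 'M[R]_n) (w : T) : nat :=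
  tree_queries (mv_decode alg) A (mv_strategy alg w).

(* Main.v *)
Require Import Defs.
From HB Require Import structures.
From mathcomp Require Import all_boot all_order all_algebra.
From mathcomp Require Import all_classical all_reals all_analysis.
From mathcomp Require Import polyrcf measurable_realfun lra.

(** The dimension is free, so take n = 2^(km) + 1. Along the run in which every
    answer is zero, the at most m queries assign to each coordinate a string of
    at most km bits, so two coordinates i != j always receive the same string.
    The matrix e_i (e_i - e_j)^T then annihilates every query and cannot be told
    apart from 0, although its trace is 1 and its norm is sqrt 2, while on the
    zero matrix the only acceptable output is 0. Hence every coin toss fails on
    0 or on one of these n(n-1) matrices, and the union bound gives
    1 <= n^2 delta. This says nothing about m = 0 with delta close to 1; there
    the output does not depend on the matrix, and the 1 x 1 matrices 2^i
    require it to lie in pairwise disjoint intervals. *)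

Import Order.TTheory GRing.Theory Num.Theory.

Local Open Scope classical_set_scope.
Local Open Scope ring_scope.

(** * Schatten norms of products of a column and a row *)

Lemma char_poly_rank1 (R : comNzRingType) (n : nat) (u : 'cV[R]_n)
    (v : 'rV[R]_n) :
  char_poly (u *m v) * 'X = ('X - ((v *m u) 0 0)%:P) * 'X^n.
Proof.
(* Sylvester's determinant identity: both sides are computed from \det M by
   clearing the lower left block of M, from the left and from the right. *)
pose up : 'cV[{poly R}]_n := map_mx polyC u.
pose vp : 'rV[{poly R}]_n := map_mx polyC v.
pose M := block_mx 1%:M vp up ('X%:M).
have detM : \det M = char_poly (u *m v).
  have := det_mulmx (block_mx 1%:M 0 (- up) 1%:M) M.
  rewrite /M mulmx_block det_lblock !det1 !mul1r => <-.
  rewrite !mul1mx !mul0mx !addr0 mulmx1 addNr det_ublock det1 mul1r.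
  by rewrite mulNmx addrC -map_mxM.
have := det_mulmx M (block_mx ('X%:M) 0 (- up) 1%:M).
rewrite detM det_lblock det1 mulr1 det_scalar1 => <-.
rewrite /M mulmx_block mul1mx mulmx0 add0r mulmxN -map_mxM.
have -> : up *m 'X%:M + 'X%:M *m - up = 0.
  by rewrite mul_mx_scalar mulmxN mul_scalar_mx subrr.
rewrite mulmx0 add0r !mulmx1 det_ublock det_scalar.
by rewrite det_mx11 !mxE eqxx mulr1n.
Qed.

Lemma sum_singular_values (R : realType) (n : nat) (f : R -> R) (A : 'M[R]_n) :
  let chi := char_poly (A^T *m A) in
  \sum_(s <- singular_values A) f s =
    \sum_(x <- rootsR chi) f (Num.sqrt x) *+ mup x chi.
Proof.
rewrite /singular_values big_flatten big_map /=.
by apply: eq_bigr => x _; rewrite big_nseq iter_addr_0.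
Qed.

(** The Gram matrix of [u *m v] is again a column times a row, so at most one singular value is
    nonzero. This is why the norm does not depend on [p]. *)
Lemma schatten_norm_rank1 (R : realType) (n : nat) (p : R) (u : 'cV[R]_n)
    (v : 'rV[R]_n) : 0 < p ->
  schatten_norm p (u *m v) = Num.sqrt ((u^T *m u) 0 0 * (v *m v^T) 0 0).
Proof.
move=> p_gt0; case: n u v => [|n] u v.
  (* For the empty matrix the empty sum is raised to the power [p^-1], which gives 0 because this
     exponent is nonzero. *)
  rewrite mxE big_ord0 mul0r sqrtr0 /schatten_norm sum_singular_values.
  rewrite /char_poly det_mx00 rootsRC big_nil powR0//.
  by rewrite invr_eq0 gt_eqF.
set c := _ * _.
have gramE : (u *m v)^T *m (u *m v) = v^T *m ((u^T *m u) 0 0 *: v).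
  rewrite trmx_mul -mulmxA (mulmxA u^T) {1}[u^T *m u]mx11_scalar.
  by rewrite mul_scalar_mx.
have chiE : char_poly ((u *m v)^T *m (u *m v)) = 'X^n * ('X - c%:P).
  have X0 : 'X != 0 :> {poly R} by rewrite polyX_eq0.
  apply: (mulIf X0).
  by rewrite gramE char_poly_rank1 -scalemxAl mxE mulrC exprSr mulrAC.
have monX i : 'X^i != 0 :> {poly R} by rewrite monic_neq0 ?monicXn.
have monXc : 'X - c%:P != 0 :> {poly R} by rewrite polyXsubC_eq0.
rewrite /schatten_norm sum_singular_values chiE.
have mupE x : x != 0 -> mup x ('X^n * ('X - c%:P)) = (c == x).
  move=> x0; rewrite mupM// -{1}['X]subr0 -polyC0 mup_XsubCX eq_sym (negPf x0).
  by rewrite add0n -['X - c%:P]expr1 mup_XsubCX; case: eqP.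
(* The root 0 contributes nothing, whatever its multiplicity. This also settles [c = 0], where [c]
   need not be a simple root. *)
have -> : \sum_(x <- rootsR ('X^n * ('X - c%:P)))
    Num.sqrt x `^ p *+ mup x ('X^n * ('X - c%:P)) = Num.sqrt c `^ p.
  have c_in : c \in rootsR ('X^n * ('X - c%:P)).
    have chi0 : 'X^n * ('X - c%:P) != 0 by rewrite mulf_neq0.
    have := roots_on_rootsR chi0 c; rewrite in_itv /= => <-.
    by rewrite rootM root_XsubC eqxx orbT.
  rewrite (big_rem c)//= big1_seq ?addr0; last first.
    move=> x /=; rewrite mem_rem_uniq ?uniq_roots// inE => /andP[xc _].
    have [->|x0] := eqVneq x 0; first by rewrite sqrtr0 powR0 ?mul0rn ?gt_eqF.
    by rewrite mupE// eq_sym (negPf xc).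
  have [->|c0] := eqVneq c 0; first by rewrite sqrtr0 powR0 ?mul0rn ?gt_eqF.
  by rewrite mupE// eqxx.
by rewrite -powRrM mulfV ?gt_eqF// powRr1 ?sqrtr_ge0.
Qed.

(** * Runs with zero answers, and the pigeonhole principle *)

Section ZeroAnswers.
Context {R : realType} {k n : nat}.
Implicit Types (t : mv_tree R k n) (decode : k.-tuple bool -> R).

Fixpoint zero_queries t : seq 'cV[k.-tuple bool]_n :=
  if t is Query q next then q :: zero_queries (next 0) else [::].

Lemma size_zero_queries decode t :
  size (zero_queries t) = tree_queries decode 0 t.
Proof. by elim: t => //= q next IH; rewrite mul0mx IH. Qed.

(** Each query on this branch is answered by 0, so by induction the run never leaves the branch
    taken for the zero matrix. *)
Lemma tree_output_kernel decode (A : 'M[R]_n) t :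
  {in zero_queries t, forall q, A *m map_mx decode q = 0} ->
  tree_output decode A t = tree_output decode 0 t.
Proof.
elim: t => //= q next IH kerA.
rewrite mul0mx kerA ?mem_head// IH// => q' q'_in.
by apply: kerA; rewrite inE q'_in orbT.
Qed.

End ZeroAnswers.

Lemma query_collision (k n m : nat) (qs : seq 'cV[k.-tuple bool]_n) :
  (size qs <= m)%N -> (2 ^ (k * m) < n)%N ->
  exists i j : 'I_n, i != j /\ {in qs, forall q : 'cV_n, q i 0 = q j 0}.
Proof.
move=> sz_qs lt_n.
(* A run with fewer than [m] queries is padded with all-false strings, so that every coordinate gets
   one of exactly [2 ^ (k * m)] codes. *)
pose col (i : 'I_n) : {ffun 'I_m -> k.-tuple bool} :=
  [ffun l : 'I_m => nth (const_mx [tuple of nseq k false]) qs l i 0].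
have /injectivePn[i [j ij eq_ij]] : ~~ injectiveb col.
  apply/negP => /injectiveP /leq_card.
  by rewrite card_ord card_ffun card_tuple card_bool card_ord -expnM leqNgt lt_n.
exists i, j; split=> // q /(nthP (const_mx [tuple of nseq k false]))[l lt_l <-].
have lt_lm := leq_trans lt_l sz_qs.
by have /ffunP/(_ (Ordinal lt_lm)) := eq_ij; rewrite !ffunE.
Qed.

(** * The hard matrices and their norms *)

Section CoordinateDifference.
Context {R : realType} {n : nat}.
Implicit Types i j : 'I_n.

Definition diff_row i j : 'rV[R]_n := delta_mx 0 i - delta_mx 0 j.

Definition diff_mx i j : 'M[R]_n := delta_mx i 0 *m diff_row i j.

Lemma diff_row_mul i j (q : 'cV[R]_n) : diff_row i j *m q = (q i 0 - q j 0)%:M.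
Proof.
by rewrite mulmxBl -!rowE [LHS]mx11_scalar !mxE.
Qed.

Lemma diff_mxii i : diff_mx i i = 0.
Proof. by rewrite /diff_mx /diff_row subrr mulmx0. Qed.

Lemma diff_mx_ker i j (q : 'cV[R]_n) : q i 0 = q j 0 -> diff_mx i j *m q = 0.
Proof.
by move=> qij; rewrite -mulmxA diff_row_mul qij subrr raddf0 mulmx0.
Qed.

Lemma tr_diff_mx i j : i != j -> \tr (diff_mx i j) = 1.
Proof.
move=> ij; rewrite mxtrace_mulC diff_row_mul mxtrace_scalar !mxE !eqxx.
by rewrite eq_sym (negPf ij) subr0.
Qed.

Lemma schatten_norm_diff_mx (p : R) i j : 0 < p -> i != j ->
  schatten_norm p (diff_mx i j) = Num.sqrt 2.
Proof.
move=> p0 ij; rewrite schatten_norm_rank1// diff_row_mul trmx_delta -rowE !mxE.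
by rewrite !eqxx/= (eq_sym j) (negPf ij) mul1r mulr1n subr0 sub0r opprK.
Qed.

End CoordinateDifference.

Lemma schatten_norm0 (R : realType) (n : nat) (p : R) : 0 < p ->
  schatten_norm p (0 : 'M[R]_n) = 0.
Proof.
move=> p0; rewrite -(mul0mx _ (0 : 'rV[R]_n)) schatten_norm_rank1//.
by rewrite trmx0 !mul0mx mxE mul0r sqrtr0.
Qed.

Lemma schatten_norm_scalar (R : realType) (p a : R) : 0 < p ->
  schatten_norm p (a%:M : 'M[R]_1) = `|a|.
Proof.
move=> p0; rewrite -[a%:M]mulmx1 schatten_norm_rank1// tr_scalar_mx trmx1 mulmx1.
by rewrite -scalar_mxM !mxE eqxx mulr1 sqrtr_sqr.
Qed.

(** * Failure probabilities and the query bound *)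

Lemma measure_fin_cover (d : measure_display) (T : measurableType d)
    (R : realType) (mu : {measure set T -> \bar R}) (I : finType)
    (F : I -> set T) :
  (forall i, measurable (F i)) -> (forall x, exists i, F i x) ->
  (mu setT <= \sum_i mu (F i))%E.
Proof.
move=> mF cover; rewrite -big_enum fsbig_seq ?enum_uniq//.
apply: content_sub_fsum => // x _; have [i Fix] := cover x.
by exists i => //=; rewrite mem_enum.
Qed.

Lemma measurable_dist_le (d : measure_display) (T : measurableType d)
    (R : realType) (f : T -> R) (a r : R) : measurable_fun [set: T] f ->
  measurable [set w | `|f w - a| <= r].
Proof.
move=> mf; rewrite -[X in measurable X]setTI; apply: measurable_fun_le => //.
by apply: measurableT_comp => //; apply: measurable_funB.
Qed.

Section LowerBound.
Context {R : realType} {k : nat} {p delta : R} {d : measure_display}.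
Context {T : measurableType d} {P : probability T R}.
Context {alg : forall n : nat, mv_algorithm R k T n} {m : nat}.
Context (p_ge1 : 1 <= p).

Let good {n} (A : 'M[R]_n) : set T :=
  [set w | `|mv_output (alg n) A w - \tr A| <= 10%:R^-1 * schatten_norm p A].

Context (mout : forall n (A : 'M[R]_n), (0 < n)%N ->
  measurable_fun [set: T] (mv_output (alg n) A)).
Context (Pgood : forall n (A : 'M[R]_n), (0 < n)%N ->
  ((1 - delta)%:E <= P (good A))%E).
Context (queries_le : forall n (A : 'M[R]_n) (w : T), (0 < n)%N ->
  (mv_queries (alg n) A w <= m)%N).

Let p_gt0 : 0 < p. Proof. exact: lt_le_trans p_ge1. Qed.

Let mgood n (A : 'M[R]_n) : (0 < n)%N -> measurable (good A).
Proof. by move=> n0; apply: measurable_dist_le; apply: mout. Qed.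

(* The case ij.1 = ij.2 stands for the zero matrix. *)
Lemma bad_diff_mx n (w : T) : (2 ^ (k * m) < n)%N ->
  exists ij : 'I_n * 'I_n, ~ good (diff_mx ij.1 ij.2) w.
Proof.
move=> lt_n; have n0 : (0 < n)%N by apply: leq_trans lt_n.
have [out0|out_neq0] := eqVneq (mv_output (alg n) 0 w) 0; last first.
  exists (Ordinal n0, Ordinal n0); rewrite /good/= diff_mxii mxtrace0 subr0.
  by rewrite schatten_norm0// mulr0 normr_le0; apply/negP.
have := queries_le n 0 w n0; rewrite /mv_queries -size_zero_queries.
move=> /query_collision/(_ lt_n)[i [j [ij eq_ij]]]; exists (i, j).
rewrite /good/= tr_diff_mx// schatten_norm_diff_mx// /mv_output.
rewrite tree_output_kernel => [|q /eq_ij qij]; last first.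
  by apply: diff_mx_ker; rewrite !mxE qij.
rewrite [tree_output _ _ _]out0 sub0r normrN normr1 => le1.
(* Success would give [1 <= sqrt 2 / 10], which this crude bound already refutes. *)
have : Num.sqrt 2 < 2 :> R.
  have := @sqr_sqrtr R 2 (ler0n _ 2); have := sqrtr_ge0 (2 : R); nra.
by lra.
Qed.

Lemma failure_lower_bound n : (2 ^ (k * m) < n)%N -> 1 <= delta *+ (n * n).
Proof.
move=> lt_n; have n0 : (0 < n)%N by apply: leq_trans lt_n.
rewrite -lee_fin -(@probability_setT _ _ _ P).
(* All [n * n] pairs are counted; the diagonal ones repeat the failure event of the zero matrix. *)
apply: (le_trans (@measure_fin_cover _ _ _ P ('I_n * 'I_n)%type
  (fun ij => ~` good (diff_mx ij.1 ij.2)) _ _)).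
- by move=> ij; apply: measurableC; apply: mgood.
- by move=> w; apply: bad_diff_mx.
apply: (@le_trans _ _ (\sum_(ij : 'I_n * 'I_n) delta%:E)%E).
  apply: lee_sum => ij _; rewrite /= probability_setC; last exact: mgood.
  rewrite leeBlDr; last by rewrite fin_num_measure//; apply: mgood.
  rewrite addeC -leeBlDr//; exact: Pgood.
by rewrite sumEFin sumr_const card_prod card_ord.
Qed.

Lemma query_needed : delta < 1 -> (0 < m)%N.
Proof.
move=> delta_lt1; rewrite lt0n; apply/eqP => m0.
have noquery (A B : 'M[R]_1) w : mv_output (alg 1) A w = mv_output (alg 1) B w.
  have := queries_le 1 A w isT; rewrite m0 /mv_queries /mv_output.
  by case: (mv_strategy _ _).
pose F i := good ((2 ^+ i)%:M : 'M[R]_1).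
(* These intervals are disjoint for distinct [i] because 11/10 is less than twice 9/10. *)
have FE i w : F i w ->
    9 / 10 * 2 ^+ i <= mv_output (alg 1) 0 w <= 11 / 10 * 2 ^+ i.
  rewrite /F /good/= (noquery _ 0) mxtrace_scalar schatten_norm_scalar//.
  rewrite normrX (ger0_norm (ler0n _ 2)) ler_distl mulr1n; lra.
have trivF : trivIset setT F.
  move=> i j _ _ [w [/FE Fi /FE Fj]]; wlog: i j Fi Fj / (i < j)%N => [wlt|lt_ij].
    by case: (ltngtP i j) => // ij; [apply: wlt|apply/esym/wlt].
  exfalso; have : 2 * 2 ^+ i <= 2 ^+ j :> R by rewrite -exprS ler_eXn2l// ltr1n.
  have : 0 < 2 ^+ i :> R by rewrite exprn_gt0.
  lra.
(* More than [1 / (1 - delta)] disjoint events, each of probability at least [1 - delta], would have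
   total mass above 1. *)
set J := (Num.trunc (1 - delta)^-1).+1.
have : (((1 - delta) *+ J)%:E <= 1)%E.
  apply: le_trans (probability_le1 P (_ : measurable (\big[setU/set0]_(i < J) F i))).
    rewrite measure_bigsetU => [|i|//]; last exact: mgood.
    apply: (@le_trans _ _ (\sum_(i < J) (1 - delta)%:E)%E).
      by rewrite sumEFin sumr_const card_ord.
    by apply: lee_sum => i _; apply: Pgood.
  by apply: bigsetU_measurable => i _; apply: mgood.
rewrite lee_fin -mulr_natr -ler_pdivlMl ?subr_gt0// mulr1 leNgt.
by rewrite truncnS_gt.
Qed.

End LowerBound.

(** For [l > 0] the dimension [2 ^ l + 1] is at most [2 ^ (2 * l)], which fails at [l = 0]; squaring
    and [ln 2 <= 1] give the factor 4. *)
Lemma ln_inv_le_of_failure (R : realType) (delta : R) (l : nat) : (0 < l)%N ->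
  0 < delta -> 1 <= delta *+ ((2 ^ l).+1 * (2 ^ l).+1) ->
  ln (1 / delta) <= (4 * l)%:R.
Proof.
move=> l0 d0 le1.
have le_pow : ((2 ^ l).+1 * (2 ^ l).+1 <= 2 ^ (4 * l))%N.
  have le2 : ((2 ^ l).+1 <= 2 ^ (2 * l))%N.
    rewrite mul2n -addnn expnD.
    by apply: ltn_Pmull; rewrite ?expn_gt0// -{1}(expn0 2) ltn_exp2l.
  by rewrite (mulnDl 2 2 l : 4 * l = _)%N expnD leq_mul.
have le_inv : 1 / delta <= 2 ^+ (4 * l).
  rewrite ler_pdivrMr// (le_trans le1)// -[leLHS]mulr_natl ler_pM2r//.
  by rewrite -natrX ler_nat.
have le_ln : ln (1 / delta) <= ln (2 ^+ (4 * l)).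
  by rewrite ler_ln// posrE ?divr_gt0// exprn_gt0.
rewrite (le_trans le_ln)// lnXn// ler_wMn2r//.
by apply: (@le_ln1Dx R 1); lra.
Qed.

Theorem theoremC4 (R : realType) :
  exists2 c : R, 0 < c &
    forall (p : R) (k : nat) (delta : R)
      (d : measure_display) (T : measurableType d) (P : probability T R)
      (alg : forall n : nat, mv_algorithm R k T n) (m : nat),
      1 <= p -> (1 <= k)%N -> 0 < delta < 1 ->
      (forall (n : nat) (A : 'M[R]_n), (0 < n)%N ->
        measurable_fun [set: T] (mv_output (alg n) A)) ->
      (forall (n : nat) (A : 'M[R]_n), (0 < n)%N ->
        ((1 - delta)%:E <=
          P [set w | (`|mv_output (alg n) A w - \tr A|
                       <= 10%:R^-1 * schatten_norm p A)%R])%E) ->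
      (forall (n : nat) (A : 'M[R]_n) (w : T), (0 < n)%N ->
        (mv_queries (alg n) A w <= m)%N) ->
      c * (ln (1 / delta) / (k%:R + Num.max 0 (ln (ln (1 / delta))))) <= m%:R.
Proof.
exists 4^-1; first by rewrite invr_gt0.
move=> p k delta d T P alg m p1 k1 /andP[d0 d1] mout Pgood queries_le.
have m0 := query_needed p1 mout Pgood queries_le d1.
have km0 : (0 < k * m)%N by rewrite muln_gt0 k1.
have le_ln := ln_inv_le_of_failure _ _ _ km0 d0
  (failure_lower_bound p1 mout Pgood queries_le _ (ltnSn _)).
have k_gt0 : 0 < k%:R :> R by rewrite ltr0n.
have max_ge0 : 0 <= Num.max 0 (ln (ln (1 / delta))) by rewrite le_max lexx.
(* It remains to bound [4 * k * m] by [4 * m] times the denominator, which is at least [k] since the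
   maximum is nonnegative. *)
rewrite ler_pdivrMl// ler_pdivrMr ?ltr_wpDr// (le_trans le_ln)//.
by rewrite [(k * m)%N]mulnC !natrM mulrA ler_wpM2l ?mulr_ge0// lerDl.
Qed.
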